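(* The Hermitian matrix integral analogue ${}_1\mathcal F_1$ of Kummer's confluent hypergeometric function satisfies $${}_1\mathcal F_1(a,c;x)=\operatorname{etr}(x)\cdot{}_1\mathcal F_1(c-a,c;-x).$$
   Context: Let $r\ge1$ be an integer, $1_r$ the identity matrix of size $r$, and $\mathscr H(r)$ the real vector space of complex Hermitian $r\times r$ matrices. For $U\in\mathscr H(r)$, write $|U|=\det U$; $U>0$ means that $U$ is positive definite; $0<U<1_r$ means $U>0$ and $1_r-U>0$; and $dU=\bigwedge_i dU_{i,i}\bigwedge_{i<j}d(\operatorname{Re}U_{i,j})\wedge d(\operatorname{Im}U_{i,j})$ is the Euclidean volume form. For a square matrix $A$, $\operatorname{etr}(A)=\exp(\operatorname{Tr}A)$. Put $$\Gamma_r(a)=\int_{U>0}\operatorname{etr}(-U)|U|^{a-r}dU,$$ $${}_1\mathcal F_1(a,c;X)=\frac{\Gamma_r(c)}{\Gamma_r(a)\Gamma_r(c-a)}\int_{0<U<1_r}|U|^{a-r}|1_r-U|^{c-a-r}\operatorname{etr}(UX)\,dU,\qquad X\in\mathscr H(r).$$ *)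

(* Defs.v *)
From HB Require Import structures.
From mathcomp Require Import all_boot all_order all_algebra complex.
From mathcomp Require Import all_classical all_reals all_analysis.

Set Implicit Arguments.
Unset Strict Implicit.
Unset Printing Implicit Defensive.

Import Order.TTheory GRing.Theory Num.Theory.
Import numFieldNormedType.Exports.

Local Open Scope classical_set_scope.
Local Open Scope ring_scope.
Local Open Scope complex_scope.
Local Open Scope sesquilinear_scope.

(* Lebesgue measure on R^n, seen as n.-tuple (measurableTypeR R) with its product
   sigma-algebra: the image under (x, t) |-> x :: t of the product of the
   Lebesgue measures on R and R^n gives the one on R^(n+1). *)
Section tuple_measure_cons.
Context (R : realType) (n : nat).
Variable m : {sigma_finite_measure set (n.-tuple (measurableTypeR R)) -> \bar R}.

Definition tuple_cons (p : measurableTypeR R * n.-tuple (measurableTypeR R)) : n.+1.-tuple (measurableTypeR R) :=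
  [tuple of p.1 :: p.2].

Lemma measurable_tuple_cons : measurable_fun [set: measurableTypeR R * n.-tuple (measurableTypeR R)] tuple_cons.
Proof. exact: measurable_cons. Qed.

Definition leb_cons : set (n.+1.-tuple (measurableTypeR R)) -> \bar R :=
  pushforward (@lebesgue_measure R \x m)%E tuple_cons.

Let leb_cons_measure :=
  measure_function_pushforward__canonical__measure_function_Measure
    (@lebesgue_measure R \x m)%E measurable_tuple_cons.

HB.instance Definition _ := isMeasure.Build _ _ _ leb_cons
  (measure0 leb_cons_measure) (measure_ge0 leb_cons_measure)
  (@measure_semi_sigma_additive _ _ _ leb_cons_measure).

Lemma leb_cons_sigma_finite :
  sigma_finite [set: n.+1.-tuple (measurableTypeR R)] leb_cons.
Proof.
have /sigma_finiteP[F [TF ndF Foo]] := sigma_finiteT (@lebesgue_measure R).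
have /sigma_finiteP[G [TG ndG Goo]] := sigma_finiteT m.
pose g (t : n.+1.-tuple (measurableTypeR R)) :
    measurableTypeR R * n.-tuple (measurableTypeR R) :=
  (thead t, [tuple of behead t]).
have mg : measurable_fun setT g.
  by apply/measurable_fun_pairP; split;
    [exact: measurable_tnth | exact: measurable_behead].
have gK p : g (tuple_cons p) = p.
  by case: p => x t; congr pair; apply/val_inj.
exists (fun k => g @^-1` (F k `*` G k)).
  rewrite -preimage_bigcup -[LHS](preimage_setT g); congr (g @^-1` _).
  rewrite -setXTT TF TG predeqE => -[x y]; split.
    move=> [/= [k _ Fkx] [l _ Gly]]; exists (maxn k l) => //; split.
    - by move: x Fkx; exact/subsetPset/ndF/leq_maxl.
    - by move: y Gly; exact/subsetPset/ndG/leq_maxr.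
  by move=> [k _ []/= ? ?]; split; exists k.
move=> k; have [mF Fk] := Foo k; have [mG Gk] := Goo k; split.
  by rewrite -[X in measurable X]setTI; apply: mg => //; exact: measurableX.
rewrite /leb_cons /pushforward -comp_preimage.
rewrite (_ : g \o tuple_cons = id); last by apply/funext => p /=; rewrite gK.
by rewrite product_measure1E// lte_mul_pinfty// ge0_fin_numE.
Qed.

HB.instance Definition _ :=
  @Measure_isSigmaFinite.Build _ _ _ leb_cons leb_cons_sigma_finite.

End tuple_measure_cons.

Fixpoint lebn (R : realType) (n : nat) :
    {sigma_finite_measure set (n.-tuple (measurableTypeR R)) -> \bar R} :=
  if n is n'.+1 return
    {sigma_finite_measure set (n.-tuple (measurableTypeR R)) -> \bar R}
  then leb_cons (lebn R n')
  else \d_([tuple] : 0.-tuple (measurableTypeR R)).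

Section boxes.
Variable R : realType.

Let cons_preim n (A : 'I_n.+1 -> set R) : @tuple_cons R n @^-1`
  [set t | forall i, A i (tnth t i)] =
  A ord0 `*` [set t | forall i, A (lift ord0 i) (tnth t i)].
Proof.
apply/seteqP; split => -[x t] /=.
  by move=> H; split => [|i]; [exact: (H ord0)|have := H (lift ord0 i); rewrite tnthS].
move=> [Ax At] i; case: (unliftP ord0 i) => [j ->|->//].
by rewrite tnthS; exact: At.
Qed.

Lemma lebn_box n (A : 'I_n -> set (measurableTypeR R)) :
  (forall i, measurable (A i)) ->
  lebn R n [set t | forall i, A i (tnth t i)] =
  (\prod_(i < n) @lebesgue_measure R (A i))%E.
Proof.
elim: n A => [|n IH] A mA.
  by rewrite big_ord0 /= diracE mem_set// => -[].
have mB k (B : 'I_k -> set (measurableTypeR R)) : (forall i, measurable (B i)) ->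
    measurable [set t : k.-tuple (measurableTypeR R) | forall i, B i (tnth t i)].
  move=> mB; rewrite (_ : [set _ | _] =
      \bigcap_(i in [set: 'I_k]) ((tnth (T:=measurableTypeR R))^~ i @^-1` B i)).
    apply: fin_bigcap_measurable => [|i _]; first exact: finite_finset.
    by rewrite -[X in measurable X]setTI; exact: measurable_tnth.
  by apply/seteqP; split => t /= => [H i _|H i]; exact: H.
rewrite big_ord_recl /= /leb_cons /pushforward cons_preim product_measure1E//.
  by congr (_ * _)%E; exact: (IH (fun i => A (lift ord0 i))).
by apply: (mB n (fun i => A (lift ord0 i))).
Qed.
End boxes.

Section hermitian_integrals.
Context {R : realType}.
Local Notation C := R[i].

Definition cexp (z : C) : C :=
  (expR (complex.Re z))%:C * (cos (complex.Im z) +i* sin (complex.Im z)).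

(* x ^ s = exp (s ln x), meant for x > 0 *)
Definition cpow (x : R) (s : C) : C := cexp (s * (ln x)%:C).

Definition cintegral d (T : measurableType d) (mu : {measure set T -> \bar R})
    (D : set T) (f : T -> C) : C :=
  (\int[mu]_(x in D) complex.Re (f x)) +i* (\int[mu]_(x in D) complex.Im (f x)).

Variable r : nat.
Implicit Types A U X : 'M[C]_r.

Definition posdef A : Prop :=
  A \is hermsymmx /\
  forall v : 'rV[C]_r, v != 0 -> 0 < (v *m A *m v ^t* ) 0 0.

Definition etr A : C := cexp (\tr A).

(* |U| ^ s; the determinant of a Hermitian matrix is real. *)
Definition detpow U (s : C) : C := cpow (complex.Re (\det U)) s.

(* The r * r real coordinates of a Hermitian matrix U: entry (i, j) of x is
   U_ii if i = j, Re U_ij if i < j, and Im U_ji if j < i. *)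
Definition hermmx (x : (r * r).-tuple (measurableTypeR R)) : 'M[C]_r :=
  let X i j : R := tnth x (mxvec_index i j) in
  \matrix_(i, j)
    if i == j then (X i i)%:C
    else if (i < j)%N then X i j +i* X j i else X j i -i* X i j.

(* The integral over {U in H(r) | P U} for the volume form dU, i.e. Lebesgue
   measure in the coordinates above. *)
Definition herm_integral (P : 'M[C]_r -> Prop) (f : 'M[C]_r -> C) : C :=
  cintegral (lebn R (r * r)) [set x | P (hermmx x)] (fun x => f (hermmx x)).

Definition herm_Gamma (a : C) : C :=
  herm_integral posdef (fun U => etr (- U) * detpow U (a - r%:R)).

(* The integrals below converge for Re a > r - 1 and Re (c - a) > r - 1; elsewhere
   a divergent real or imaginary part takes the default value of Rintegral. *)
Definition herm_1F1 (a c : C) X : C :=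
  herm_Gamma c / (herm_Gamma a * herm_Gamma (c - a)) *
  herm_integral (fun U => posdef U /\ posdef (1%:M - U))
    (fun U => detpow U (a - r%:R) * detpow (1%:M - U) (c - a - r%:R) *
              etr (U *m X)).

Lemma hermmx_herm x : hermmx x \is hermsymmx.
Proof.
apply/is_hermitianmxP/matrixP => i j; rewrite expr0 scale1r !mxE.
have [->|ij] := eqVneq i j; first by congr Complex; rewrite oppr0.
case: ltngtP => [ij'|ji|/val_inj eij].
- by congr Complex; rewrite opprK.
- by [].
- by rewrite eij eqxx in ij.
Qed.

Lemma hermmx_inj : injective hermmx.
Proof.
move=> x y /matrixP xy; apply: eq_from_tnth => k.
case/mxvec_indexP: k => i j.
have := xy i j; have := xy j i; rewrite !mxE.
have [->|ij] := eqVneq i j; first by move=> _ [].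
case: ltngtP => [ji|ij'|/val_inj eij]; last by rewrite eij eqxx in ij.
  by move=> [_ ->].
by move=> [->].
Qed.

Lemma hermmx_surj U : U \is hermsymmx -> exists x, hermmx x = U.
Proof.
move=> /is_hermitianmxP /matrixP HU.
pose F (i j : 'I_r) : measurableTypeR R :=
  if (i <= j)%N then complex.Re (U i j) else complex.Im (U j i).
exists [tuple mxvec (\matrix_(i, j) F i j) 0 k | k < r * r].
have HE i j : U i j = (U j i)^*%C by rewrite {1}HU expr0 scale1r !mxE.
apply/matrixP => i j; rewrite !mxE !tnth_mktuple !mxvecE !mxE /F.
have [<-|ij] := eqVneq i j.
  rewrite leqnn; have := HE i i; case: (U i i) => a b /= -[/eqP].
  by rewrite -addr_eq0 -mulr2n mulrn_eq0 /= => /eqP ->.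
case: ltngtP => [ij'|ji|/val_inj eij]; last by rewrite eij eqxx in ij.
  by case: (U i j).
by rewrite (HE i j); case: (U j i).
Qed.

End hermitian_integrals.

(* Main.v *)
(* The substitution U -> 1 - U preserves the volume form and the domain
   0 < U < 1, exchanges the two determinant powers, and turns etr(U x) into
   etr(x) etr(- U x); the Gamma factor is symmetric in a and c - a.
   As a and c are arbitrary, the integrals may diverge; but the change of
   variables by a measure-preserving involution and the extraction of the factor
   etr(x), which is real and positive, hold for every function, measurable or not,
   since the integral is a difference of suprema over simple functions. *)

Require Import Defs.
From HB Require Import structures.
From mathcomp Require Import all_boot all_order all_algebra complex.
From mathcomp Require Import all_classical all_reals all_analysis.
From mathcomp Require Import measurable_realfun ring lra.

Set Implicit Arguments.
Unset Strict Implicit.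
Unset Printing Implicit Defensive.

Import Order.TTheory GRing.Theory Num.Theory.

Local Open Scope classical_set_scope.
Local Open Scope ring_scope.
Local Open Scope complex_scope.

(** A real [k > 0] fixes [+oo] and [-oo], so it distributes even over [+oo - +oo], where the value
    is a convention of [\bar R]. *)
Lemma gt0_muleBr (R : realDomainType) (k : R) (p q : \bar R) : 0 < k ->
  (k%:E * (p - q) = k%:E * p - k%:E * q)%E.
Proof.
move=> k0; have ky : (k%:E * +oo = +oo)%E by rewrite gt0_muley ?lte_fin.
have kNy : (k%:E * -oo = -oo)%E by rewrite gt0_muleNy ?lte_fin.
by case: p q => [p| |] [q| |]; rewrite /= ?ky ?kNy //= -?EFinM -?EFinB ?mulrBr.
Qed.

Section nonmeasurable_integral.
Local Open Scope ereal_scope.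
Context d (T : measurableType d) (R : realType).
Variable mu : {measure set T -> \bar R}.
Import HBNNSimple.

Section involution.
Variable phi : T -> T.
Hypothesis mphi : measurable_fun [set: T] phi.
Hypothesis phiK : involutive phi.
Hypothesis mu_phi : forall A, measurable A -> mu (phi @^-1` A) = mu A.

(** A simple [h] below [f] yields the simple function [h \o phi] below [f \o phi], with the same
    integral because [phi] preserves [mu]; so the suprema compare. *)
Let ge0_integral_comp_le (f : T -> \bar R) : (forall x, 0 <= f x) ->
  \int[mu]_x f x <= \int[mu]_x f (phi x).
Proof.
move=> f0; rewrite !ge0_integralTE//; apply: ge_ereal_sup => _ [h hf <-].
have mh : measurable_fun setT (h \o phi) by exact: measurableT_comp.
have fh : finite_set (range (h \o phi)).
  apply: (sub_finite_set _ (fimfunP h)) => _ [x _ <-].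
  by exists (phi x).
have h0 x : (0 <= (h \o phi) x)%R by exact: fun_ge0.
pose h' : {nnsfun T >-> R} := HB.pack (h \o phi)
  (isMeasurableFun.Build _ _ _ _ _ mh) (FiniteImage.Build _ _ _ fh)
  (isNonNegFun.Build _ _ _ h0).
apply: ereal_sup_ubound; exists h' => [x|]; first exact: hf.
rewrite !sintegralET; apply: eq_fsbigr => x _; congr (_ * _).
by rewrite -[RHS]mu_phi.
Qed.

(** Applying the inequality to [f] and then to [f \o phi] gives equality for nonnegative functions,
    as [phi] is its own inverse; the general case splits into positive and negative parts. *)
Lemma integral_comp_involution D (f : T -> \bar R) :
  \int[mu]_(x in phi @^-1` D) f (phi x) = \int[mu]_(x in D) f x.
Proof.
have nn g : (forall x, 0 <= g x) -> \int[mu]_x g (phi x) = \int[mu]_x g x.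
  move=> g0; apply/eqP; rewrite eq_le ge0_integral_comp_le// andbT.
  rewrite (le_trans (ge0_integral_comp_le _))//.
  by under eq_integral do rewrite phiK.
rewrite integral_mkcond [RHS]integral_mkcond (_ : _ \_ _ = (f \_ D) \o phi)//.
by rewrite integralE [RHS]integralE funepos_comp funeneg_comp !nn.
Qed.

End involution.

Let ge0_integralZl_le (k : R) (f : T -> \bar R) :
  (0 < k)%R -> (forall x, 0 <= f x) ->
  k%:E * \int[mu]_x f x <= \int[mu]_x (k%:E * f x).
Proof.
move=> k0 f0; have kf0 x : 0 <= k%:E * f x by rewrite mule_ge0// lee_fin ltW.
rewrite !ge0_integralTE// muleC -lee_pdivlMr//.
apply: ge_ereal_sup => _ [h hf <-]; rewrite lee_pdivlMr// muleC.
apply: ereal_sup_ubound; exists (scale_nnsfun h (ltW k0)).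
  by move=> x /=; rewrite EFinM lee_pmul2l.
exact: sintegralrM.
Qed.

Lemma integralZl_gt0 D (k : R) (f : T -> \bar R) : (0 < k)%R ->
  \int[mu]_(x in D) (k%:E * f x) = k%:E * \int[mu]_(x in D) f x.
Proof.
move=> k0; have nn g : (forall x, 0 <= g x) ->
    \int[mu]_x (k%:E * g x) = k%:E * \int[mu]_x g x.
  move=> g0; apply/eqP; rewrite eq_le ge0_integralZl_le// andbT.
  (* The reverse inequality is the same one for the factor [k^-1] and the function [k * g]. *)
  rewrite [leRHS]muleC -lee_pdivrMr// muleC.
  have k1 : (0 < k^-1)%R by rewrite invr_gt0.
  have kg0 x : 0 <= k%:E * g x by rewrite mule_ge0// lee_fin ltW.
  apply: (le_trans (ge0_integralZl_le k1 kg0)).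
  by under eq_integral do rewrite muleA -EFinM mulVf ?gt_eqF// mul1e.
rewrite integral_mkcond [in RHS]integral_mkcond.
rewrite (_ : _ \_ _ = (fun x => k%:E * (f \_ D) x)).
  rewrite integralE [in RHS]integralE ge0_funeposM ?ge0_funenegM ?(ltW k0)//.
  by rewrite !nn// -gt0_muleBr.
by apply/funext => x; rewrite !patchE; case: ifP; rewrite ?mule0.
Qed.

End nonmeasurable_integral.

(** The pushforward agrees with Lebesgue measure on bounded half-open intervals, hence everywhere by
    uniqueness. *)
Lemma lebesgue_measure_reflect (R : realType) (e : R) (A : set R) :
  measurable A ->
  lebesgue_measure ((fun x : measurableTypeR R => e - x) @^-1` A) =
  lebesgue_measure A.
Proof.
move=> mA.
have mf : measurable_fun setT (fun x : measurableTypeR R => (e - x : measurableTypeR R)).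
  exact: measurable_funB.
pose nu := measure_function_pushforward__canonical__measure_function_Measure
    (@lebesgue_measure R) mf.
have := @lebesgue_measure_unique R nu _ A mA.
move=> -> // X [[a b]] _ <-; rewrite /nu /= /pushforward.
(* Reflection moves the closed end of []a, b]] to the left and keeps the length. *)
rewrite (_ : _ @^-1` _ = `[e - b, e - a[%classic).
  rewrite !lebesgue_measure_itv/= !lte_fin ltrD2l ltrN2; case: ifP => // _.
  by rewrite -!EFinB; congr EFin; lra.
by apply/seteqP; split => x /=; rewrite !in_itv /= => /andP[? ?]; apply/andP; split; lra.
Qed.

Definition reflect_tuple (R : realType) n (e x : n.-tuple (measurableTypeR R)) :
    n.-tuple (measurableTypeR R) :=
  [tuple (tnth e i - tnth x i : R) | i < n].

Lemma reflect_tupleK (R : realType) n (e : n.-tuple (measurableTypeR R)) :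
  involutive (@reflect_tuple R n e).
Proof. by move=> x; apply: eq_from_tnth => i; rewrite !tnth_mktuple subKr. Qed.

Lemma measurable_reflect_tuple (R : realType) n (e : n.-tuple (measurableTypeR R)) :
  measurable_fun setT (reflect_tuple e).
Proof.
apply/measurable_fun_tnthP => i.
rewrite (_ : _ \o _ = fun x => (tnth e i - tnth x i : R)); last first.
  by apply/funext => x /=; rewrite tnth_mktuple.
by apply: measurable_funB => //; exact: measurable_tnth.
Qed.

(** Induction on the dimension: the measure of [A] integrates the measures of its sections over the
    first coordinate. The reflection of that coordinate is a substitution in this outer integral,
    and the induction hypothesis treats the sections. *)
Lemma lebn_reflect_tuple (R : realType) n (e : n.-tuple (measurableTypeR R)) A :
  measurable A -> lebn R n (reflect_tuple e @^-1` A) = lebn R n A.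
Proof.
elim: n e A => [|n IH] e A mA.
  by congr (lebn R 0 _); apply/seteqP; split => x /=;
    rewrite [reflect_tuple _ _]tuple0 [x]tuple0.
rewrite /= /leb_cons /pushforward; set B := @tuple_cons R n @^-1` A.
have mB : measurable B by rewrite -[B]setTI; exact: measurable_tuple_cons.
pose e0 : measurableTypeR R := thead e.
pose e' := [tuple of behead e].
rewrite /product_measure1 /=.
rewrite -[RHS](@integral_comp_involution _ _ _ lebesgue_measure (fun x => (e0 - x : R))) /=.
- rewrite preimage_setT; apply: eq_integral => x _ /=.
  rewrite -[RHS](IH e'); last exact: measurable_xsection.
  congr (lebn R n _); apply/seteqP.
  have E y : reflect_tuple e (tuple_cons (x, y)) =
      tuple_cons ((e0 - x : R), reflect_tuple e' y).
    apply: eq_from_tnth => i; rewrite tnth_mktuple.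
    case: (unliftP ord0 i) => [j ->|->]; rewrite ?tnthS ?tnth0 /=.
      by rewrite tnth_mktuple tnth_behead; congr (tnth _ _ - _);
         apply/val_inj; rewrite /= inordK// ltnS.
    by [].
  by split => y; rewrite /xsection /= !inE /= E.
- exact: measurable_funB.
- by move=> x; rewrite subKr.
- exact: lebesgue_measure_reflect.
Qed.

Lemma hermmx_reflect_tuple (R : realType) r (e x : (r * r).-tuple (measurableTypeR R)) :
  hermmx (reflect_tuple e x) = hermmx e - hermmx x.
Proof.
apply/matrixP => i j; rewrite !mxE !tnth_mktuple.
by case: ifP => _; [|case: ifP => _]; apply/eqP;
  rewrite eq_complex /= ?oppr0 ?addr0 ?opprD ?opprK !eqxx.
Qed.

(** With [e] the coordinates of the identity matrix, [U -> 1 - U] becomes [reflect_tuple e], a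
    measure-preserving involution. *)
Lemma herm_integral_1sub (R : realType) r (P : 'M[R[i]]_r -> Prop) f :
  herm_integral (fun U => P (1%:M - U)) (fun U => f (1%:M - U)) =
  herm_integral P f.
Proof.
have h1 : (1%:M : 'M[R[i]]_r) \is hermsymmx.
  by apply/is_hermitianmxP; rewrite expr0 scale1r trmx1 map_mx1.
have [e he] := hermmx_surj h1.
have E x : 1%:M - hermmx x = hermmx (reflect_tuple e x).
  by rewrite hermmx_reflect_tuple he.
have I (g : 'M[R[i]]_r -> R) :
    Rintegral (lebn R (r * r)) [set x | P (1%:M - hermmx x)]
      (fun x => g (1%:M - hermmx x)) =
    Rintegral (lebn R (r * r)) [set x | P (hermmx x)] (fun x => g (hermmx x)).
  rewrite /Rintegral; congr fine.
  rewrite -[RHS](integral_comp_involution (measurable_reflect_tuple e)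
    (@reflect_tupleK _ _ e) (@lebn_reflect_tuple _ _ e)).
  by congr integral; apply/funext => x; rewrite /= E.
by rewrite /herm_integral /cintegral (I (fun U => complex.Re (f U)))
  (I (fun U => complex.Im (f U))).
Qed.

Lemma herm_integralZl (R : realType) r (P : 'M[R[i]]_r -> Prop) (k : R) f : 0 < k ->
  herm_integral P (fun U => k%:C * f U) = k%:C * herm_integral P f.
Proof.
move=> k0; pose mu := lebn R (r * r).
have I D (g : _ -> R) : Rintegral mu D (fun x => k * g x) = k * Rintegral mu D g.
  rewrite /Rintegral; under eq_integral do rewrite EFinM.
  (* An infinite integral stays infinite after scaling, and [fine] sends both to 0. *)
  by rewrite integralZl_gt0//; case: (integral _ _ _) => [s| |] //=;
    rewrite ?gt0_muley ?gt0_muleNy ?lte_fin//= mulr0.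
have ReM (z : R[i]) : complex.Re (k%:C * z) = k * complex.Re z.
  by case: z => u v /=; rewrite mul0r subr0.
have ImM (z : R[i]) : complex.Im (k%:C * z) = k * complex.Im z.
  by case: z => u v /=; rewrite mul0r addr0.
rewrite /herm_integral /cintegral.
under eq_Rintegral do rewrite ReM.
under [X in _ +i* X]eq_Rintegral do rewrite ImM.
by rewrite !I; apply/eqP; rewrite eq_complex ReM ImM /= !eqxx.
Qed.

Lemma cexpD (R : realType) : {morph @cexp R : z w / z + w >-> z * w}.
Proof.
move=> [a b] [c d]; apply/eqP; rewrite eq_complex /= expRD cosD sinD.
by apply/andP; split; apply/eqP; ring.
Qed.

(** The trace of a Hermitian matrix equals its conjugate, so it is real; hence [etr x] is a positive
    real factor that can enter the integral. *)
Lemma etr_herm (R : realType) r (x : 'M[R[i]]_r) : x \is hermsymmx ->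
  etr x = (expR (complex.Re (\tr x)))%:C.
Proof.
move=> /is_hermitianmxP hx.
have : complex.Im (\tr x) = 0.
  have /eqP : \tr x = (\tr x)^*%C.
    rewrite {1}hx expr0 scale1r /mxtrace rmorph_sum; apply: eq_bigr => i _.
    by rewrite !mxE.
  by rewrite eq_complex => /andP[_] /eqP /=; case: (\tr x) => u v /=; lra.
by rewrite /etr /cexp => ->; rewrite cos0 sin0 mulr1.
Qed.

Theorem proposition5p12 (R : realType) (r : nat) (hr : (1 <= r)%N)
  (a c : R[i]) (x : 'M[R[i]]_r) (hx : x \is hermsymmx) :
  herm_1F1 a c x = etr x * herm_1F1 (c - a) c (- x).
Proof.
(* Since [c - (c - a) = a], the Gamma factors agree up to order and cancel. *)
rewrite /herm_1F1 subKr [herm_Gamma _ (c - a) * _]mulrC mulrCA; congr (_ * _).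
rewrite (etr_herm hx) -herm_integralZl ?expR_gt0// -(etr_herm hx).
rewrite -[RHS]herm_integral_1sub.
apply: (f_equal2 (@herm_integral R r)).
  by apply/funext => U; apply/propext; rewrite subKr; split=> -[].
(* The exponentials match because [x - (1 - U) x = U x]. *)
apply/funext => U; rewrite subKr [RHS]mulrCA [detpow (1%:M - U) _ * _]mulrC.
congr (_ * _); rewrite mulmxN mulmxBl mul1mx opprB.
by rewrite /etr -cexpD -raddfD /= addrC subrK.
Qed.
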